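(* Let $\tau$ be a combinatorial type in $\mathcal{C}_q$ with $\operatorname{des}(\tau)=d \geq 2$ and $\operatorname{sym}(\tau)=s$. Take a representative cycle $\sigma$ for $\tau$ with $\mathbf{sig}(\sigma)=(a_1,\ldots,a_q)$ and $a_q=1$, and let $\mathcal{O}$ be the unique realization of $\sigma$ under $\mathbf{m}_d$. Then, the rotated copies $$\mathcal{O}-\frac{j}{d-1} \pmod{\mathbb{Z}} \qquad \text{for} \quad 0 \leq j<\frac{d-1}{s}$$ form all the realizations of $\tau$ under $\mathbf{m}_d$. Furthermore, each of these $(d-1)/s$ orbits is invariant under the rigid rotation $x \mapsto x-1/s \pmod{\mathbb{Z}}$.
   Context: Fix an integer $q\ge 2$. $\mathcal{S}_q$ is the group of permutations of $\mathbb{Z}/q\mathbb{Z}$, whose elements are identified with their representatives in $\{1,\dots,q\}$ (indices are taken modulo $q$). $\mathcal{C}_q\subset\mathcal{S}_q$ is the set of $q$-cycles. $\rho\in\mathcal{C}_q$ is $\rho(i)=i+1 \pmod q$, and $\mathcal{R}_q=\langle\rho\rangle$ acts on $\mathcal{C}_q$ by conjugation. A combinatorial type in $\mathcal{C}_q$ is an orbit $[\sigma]=\{\rho^j\sigma\rho^{-j}: j\in\mathbb{Z}\}$ of this action. The symmetry order $\operatorname{sym}(\sigma)$ is the order of the stabilizer $\{\rho^i:\rho^i\sigma\rho^{-i}=\sigma\}$. Descent number: $\operatorname{des}(\sigma)=\#\{i\in\mathbb{Z}/q\mathbb{Z}:\sigma(i)>\sigma(i+1)\}$, where the inequality uses the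 linear order of the representatives $1,\dots,q$ and $i=q$ is included (comparing $\sigma(q)$ with $\sigma(1)$). Both $\operatorname{des}$ and $\operatorname{sym}$ are constant on combinatorial types, so $\operatorname{des}(\tau)$ and $\operatorname{sym}(\tau)$ are defined as the values at any $\sigma\in\tau$. For $a\ne b$ in $\mathbb{Z}/q\mathbb{Z}$, $[a,b)$ denotes the cyclic interval $\{a,a+1,\dots,b-1\}$ (mod $q$). The signature of $\sigma\in\mathcal{C}_q$ is $\mathbf{sig}(\sigma)=(a_1,\dots,a_q)$ where $a_i=1$ if $i\in[\sigma(i),\sigma(i+1))$ and $a_i=0$ otherwise. For an integer $d\ge2$, $\mathbf{m}_d:\mathbb{R}/\mathbb{Z}\to\mathbb{R}/\mathbb{Z}$ is $\mathbf{m}_d(x)=dx \pmod{\mathbb{Z}}$. A period $q$ orbit is $\mathcal{O}=\{x_1,\dots,x_q\}$, with $q$ distinct points labeled (by representatives in $[0,1)$) so that $0<x_1<\dots<x_q<1$. $\mathcal{O}$ is a realization of $\sigma\in\mathcal{C}_q$ under $\mathbf{m}_d$ if $\mathbf{m}_d(x_i)=x_{\sigma(i)}$ for all $i$; it is a realization of a combinatorial type $\tau$ if it is a realization of some $\sigma\in\tau$. When $\operatorname{des}(\sigma)=d\ge2$ and $a_q=1$, $\sigma$ has exactly one realization under $\mathbf{m}_d$. *)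

(* Defs.v *)
From HB Require Import structures.
From mathcomp Require Import all_boot all_order all_algebra all_fingroup.
From mathcomp Require Import all_classical all_reals.

Set Implicit Arguments.
Unset Strict Implicit.
Unset Printing Implicit Defensive.

Import GroupScope.

(* Z/qZ is 'I_q: the ordinal k stands for the representative k + 1 in
   {1, ..., q}.  This relabelling preserves the linear order and the successor
   map ordS, and the last index q becomes the ordinal q - 1. *)

Definition rho (q : nat) : {perm 'I_q} := perm (@ordS_inj q).

Definition qcycles (q : nat) : {set {perm 'I_q}} :=
  [set sigma | porbits sigma == [set [set: 'I_q]]].

(* Permutations act on the right in the library, so that
   'J sigma (rho ^+ j) = sigma ^ (rho ^+ j) is the permutation
   rho^j o sigma o rho^-j. *)
Definition comb_type (q : nat) (sigma : {perm 'I_q}) : {set {perm 'I_q}} :=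
  orbit 'J <[rho q]> sigma.

Definition comb_types (q : nat) : {set {set {perm 'I_q}}} :=
  [set comb_type sigma | sigma in qcycles q].

Definition sym_order (q : nat) (sigma : {perm 'I_q}) : nat :=
  #|'C_(<[rho q]>)[sigma | 'J]|.

Definition des (q : nat) (sigma : {perm 'I_q}) : nat :=
  #|[set i | sigma (ordS i) < sigma i]|.

(* The values of des and sym_order at some element of tau; by des_typeE and
   sym_typeE below the choice is irrelevant. *)
Definition des_type (q : nat) (tau : {set {perm 'I_q}}) : nat :=
  if [pick sigma in tau] is Some sigma then des sigma else 0.

Definition sym_type (q : nat) (tau : {set {perm 'I_q}}) : nat :=
  if [pick sigma in tau] is Some sigma then sym_order sigma else 0.

Lemma des_conj_rho (q : nat) (sigma : {perm 'I_q}) :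
  des (sigma ^ rho q) = des sigma.
Proof.
have ordSE (i : 'I_q) : rho q i = ordS i by rewrite permE.
have reS (F : 'I_q -> nat) : \sum_i F (ordS i) = \sum_i F i.
  by rewrite [RHS](reindex_inj (@ordS_inj q)).
have desE (s : {perm 'I_q}) : des s = \sum_i (s (ordS i) < s i : nat).
  rewrite /des -sum1_card big_mkcond /=; apply: eq_bigr => i _.
  by rewrite inE; case: ltnP.
rewrite !desE -[LHS]reS.
pose M (i : 'I_q) : nat := (i.+1 == q).
apply/eqP; rewrite -(eqn_add2r (\sum_i M (sigma i))).
rewrite -{2}(reS (fun i => M (sigma i))) -!big_split /=.
apply/eqP; apply: eq_bigr => i _; rewrite /M -!ordSE !permJ !ordSE.
move: (sigma i) (sigma (ordS i)) => [a la] [b lb] /=.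
have modS c : c < q -> c.+1 %% q = if c.+1 == q then 0 else c.+1.
  move=> lc; case: eqP => [->|/eqP nq]; first by rewrite modnn.
  by rewrite modn_small // ltn_neqAle nq.
rewrite !modS //; case: (a.+1 =P q) => Ea; case: (b.+1 =P q) => Eb;
  rewrite ?ltn0 ?ltnS //=.
- have -> : a = b by apply: succn_inj; rewrite Ea Eb.
  by rewrite ltnn.
- have -> // : b < a by rewrite ltn_neqAle -ltnS Ea lb andbT -eqSS Ea; apply/eqP.
- by rewrite ltnNge -ltnS Eb la.
Qed.

Lemma comb_types_eq (q : nat) (tau : {set {perm 'I_q}}) (sigma : {perm 'I_q}) :
  tau \in comb_types q -> sigma \in tau -> tau = comb_type sigma.
Proof.
case/imsetP => sigma0 _ -> sigmaP; apply/esym/eqP.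
by rewrite /comb_type orbit_eq_mem.
Qed.

Lemma des_typeE (q : nat) (tau : {set {perm 'I_q}}) (sigma : {perm 'I_q}) :
  tau \in comb_types q -> sigma \in tau -> des_type tau = des sigma.
Proof.
move=> tauP sigma_tau; rewrite /des_type; case: pickP => [sigma'|/(_ sigma)];
  last by rewrite sigma_tau.
rewrite (comb_types_eq tauP sigma_tau) => /orbitP [r /cycleP [j ->] <-] /=.
by elim: j => [|j IHj]; rewrite ?conjg1 // expgSr conjgM des_conj_rho.
Qed.

Lemma sym_typeE (q : nat) (tau : {set {perm 'I_q}}) (sigma : {perm 'I_q}) :
  tau \in comb_types q -> sigma \in tau -> sym_type tau = sym_order sigma.
Proof.
move=> tauP sigma_tau; rewrite /sym_type; case: pickP; last first.
  by move=> /(_ sigma); rewrite sigma_tau.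
move=> sigma' sigma'_tau.
have tau_gt0 : 0 < #|tau| by apply/card_gt0P; exists sigma.
have symE sigma0 : sigma0 \in tau ->
    (#|tau| * sym_order sigma0)%N = #|<[rho q]>|.
  by move=> /(comb_types_eq tauP) ->; exact: card_orbit_stab.
by apply/eqP; rewrite -(eqn_pmul2l tau_gt0) !symE.
Qed.

(* [a, b) = {a, a + 1, ..., b - 1} modulo q: for a != b the number of terms is
   the residue of b - a modulo q. *)
Definition cyc_interval (q : nat) (a b : 'I_q) : {set 'I_q} :=
  [set c : 'I_q | (c + q - a) %% q < (b + q - a) %% q].

Definition sig (q : nat) (sigma : {perm 'I_q}) : q.-tuple nat :=
  [tuple (i \in cyc_interval (sigma i) (sigma (ordS i)) : nat) | i < q].

Section Circle.

Import Order.TTheory GRing.Theory Num.Theory.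
Local Open Scope ring_scope.
Local Open Scope quotient_scope.
Local Open Scope classical_set_scope.

Definition int_subgroup (R : realType) : zmodClosed R :=
  GRing.ZmodClosed.clone R (@Num.int_num_subdef R) _.

Definition circle (R : realType) : Type := Quotient.quot (int_subgroup R).

HB.instance Definition _ (R : realType) := GRing.Zmodule.on (circle R).

Definition to_circle (R : realType) (x : R) : circle R :=
  \pi_(Quotient.quot (int_subgroup R)) x.

Lemma to_circle_eq (R : realType) (x y : R) :
  to_circle x = to_circle y <-> x - y \is a Num.int.
Proof.
rewrite Quotient.idealrBE; split => [E|/eqP E]; last exact: E.
by apply/eqP; exact: E.
Qed.

Lemma to_circle_is_zmod_morphism (R : realType) :
  zmod_morphism (@to_circle R).
Proof. exact: (raddfB (\pi_(Quotient.quot (int_subgroup R)))). Qed.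

HB.instance Definition _ (R : realType) :=
  GRing.isZmodMorphism.Build R (circle R) (@to_circle R)
    (@to_circle_is_zmod_morphism R).

Definition mult_map (R : realType) (d : nat) (t : circle R) : circle R := t *+ d.

Definition rotate_back (R : realType) (a : R) (O : set (circle R)) :
    set (circle R) :=
  [set t - to_circle a | t in O].

Definition realizes (R : realType) (q d : nat) (sigma : {perm 'I_q})
    (O : set (circle R)) : Prop :=
  exists x : 'I_q -> R,
    [/\ forall i, 0 < x i < 1,
        forall i j : 'I_q, (i < j)%N -> x i < x j,
        O = range (fun i => to_circle (x i))
      & forall i, mult_map d (to_circle (x i)) = to_circle (x (sigma i))].

Definition realizes_type (R : realType) (q d : nat) (tau : {set {perm 'I_q}})
    (O : set (circle R)) : Prop :=
  exists2 sigma, sigma \in tau & realizes d sigma O.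

End Circle.

(* Main.v *)
Require Import Defs.
From mathcomp Require Import all_boot all_order all_algebra all_fingroup.
From mathcomp Require Import cyclic.
From mathcomp Require Import all_classical all_reals.
From mathcomp Require Import ring lra zify.

Set Implicit Arguments.
Unset Strict Implicit.
Unset Printing Implicit Defensive.

Import Order.TTheory GRing.Theory Num.Theory.
Local Open Scope ring_scope.

(** A realization is unrolled into its lift: the increasing sequence [X] of
    reals with [X (n + q) = X n + 1] that runs through the representatives of
    its points. On lifts, a cyclic relabelling of the points is a shift of the
    index and conjugates [sigma] by a power of [rho] ([lift_shift]), while a
    rotation of the orbit is the addition of a constant. So realizations of the
    type of [sigma] are the same as lifts for [sigma] itself ([realizes_lift],
    [lift_realizes]), up to the choice of the first point.

    Multiplication by [d] stretches the arc between neighbours to the arc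
    between their images plus a number of full turns. As the image arcs already
    wind [des sigma = d] times around the circle, nothing is left for extra
    turns ([lift_gap]). The lift is thus governed by a linear system, and the
    difference [u] of two lifts satisfies [d * u - u \o sigma = c]: since
    multiplication by [d] is expanding and [sigma] has finite order, [u] is the
    constant [c / (d - 1)], where [c] is an integer ([lift_rigid]). Hence all
    the realizations of the type are rotations of one of them by multiples of
    [1 / (d - 1)], and all these rotations are realizations.

    It remains to see which rotations fix the orbit. The stabilizer of [sigma]
    is generated by [rho ^+ (q / s)] ([sym_order_stab]). Rigidity turns the
    corresponding shift into a rotation, and as [s] of these shifts make a full
    turn the angle is [1 / s]; it is a multiple of [1 / (d - 1)], so [s] divides
    [d - 1] ([lift_symmetry]). Conversely a rotation of the orbit to itself
    preserves the cyclic order, hence is a shift ([points_inj]) and comes from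
    the stabilizer, so its angle is a multiple of [1 / s]. The copies therefore
    repeat with period exactly [(d - 1) / s]. *)

(** * The rotation group and the stabilizer of a permutation *)

Lemma rho_expE (q k : nat) (i : 'I_q) :
  ((rho q ^+ k)%g i = (i + k) %% q :> nat)%N.
Proof.
elim: k => [|k IHk]; first by rewrite expg0 perm1 addn0 modn_small.
by rewrite expgSr permM permE /= IHk -addn1 modnDml addn1 addnS.
Qed.

Lemma order_rho (q : nat) : (0 < q)%N -> #[rho q]%g = q.
Proof.
move=> q0; apply/eqP; rewrite eqn_dvd order_dvdn; apply/andP; split.
  apply/eqP/permP => i; rewrite perm1; apply: ord_inj.
  by rewrite rho_expE modnDr modn_small.
have /(congr1 (fun t : {perm 'I_q} => t (Ordinal q0))) := expg_order (rho q).
by rewrite perm1 => /(congr1 (@nat_of_ord q)); rewrite rho_expE add0n => /eqP.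
Qed.

(** A subgroup of the cyclic group generated by [rho] is determined by its
    order, so the stabilizer consists of the powers of [rho ^+ (q / s)]. *)
Lemma sym_order_stab (q : nat) (sigma : {perm 'I_q}) : (0 < q)%N ->
  (sym_order sigma %| q)%N /\
  forall k : nat, (sigma ^ (rho q ^+ k) = sigma)%g <->
    (q %/ sym_order sigma %| k)%N.
Proof.
move=> q0; set s := sym_order sigma.
have sub : ('C_(<[rho q]>)[sigma | 'J] \subset <[rho q]>)%g by apply: subsetIl.
have sq : (s %| q)%N by rewrite -[X in (_ %| X)%N](order_rho q0) orderE cardSg.
split=> // k.
have := cycle_sub_group (a := rho q) (m := s); rewrite order_rho // => /(_ sq).
move=> /setP/(_ ('C_(<[rho q]>)[sigma | 'J])%G); rewrite !inE sub eqxx /=.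
move=> /esym/eqP/(congr1 val) /= CE.
have -> : (sigma ^ (rho q ^+ k) = sigma)%g <->
    (rho q ^+ k \in 'C_(<[rho q]>)[sigma | 'J])%g.
  rewrite inE mem_cycle /=; split => [e|/astab1P //]; exact/astab1P.
rewrite CE; split.
  case/cycleP => j /eqP; rewrite -expgM eq_expg_mod_order order_rho // => /eqP e.
  have dq : (q %/ s %| q)%N by apply/dvdnP; exists s; rewrite mulnC divnK.
  rewrite /dvdn -(modn_dvdm _ dq) e modn_dvdm //; exact: dvdn_mulr.
by case/dvdnP => j ->; rewrite mulnC expgM mem_cycle.
Qed.

Lemma qcycle_nofix (q : nat) (sigma : {perm 'I_q}) (i : 'I_q) : (2 <= q)%N ->
  sigma \in qcycles q -> sigma i != i.
Proof.
move=> q2; rewrite inE => /eqP cyc; apply/eqP => fixi.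
have : porbit sigma i \in porbits sigma by apply: imset_f.
rewrite cyc inE => /eqP /(congr1 (fun A : {set 'I_q} => #|A|)).
rewrite cardsT card_ord => cq.
have sub : porbit sigma i \subset [set i]%SET.
  apply/fintype.subsetP => j /porbitP [n ->]; rewrite inE; apply/eqP.
  by elim: n => [|n IHn]; rewrite ?perm1 // expgSr permM IHn.
by have := subset_leq_card sub; rewrite cards1 cq leqNgt q2.
Qed.

(** * Cyclically ordered sets as quasi-periodic sequences *)

Section Lifts.
Variable R : realType.
Implicit Types (X Y : nat -> R).

Lemma eq_int (x y : R) : x \is a Num.int -> x = y -> y \is a Num.int.
Proof. by move=> xint <-. Qed.

(** The increasing enumerations, from some term on, of the preimage in the reals
    of a set of [q] points of the circle. Indices are natural numbers, rather
    than elements of ['I_q], so that a change of the first point is a plain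
    translation of the index. *)
Definition circular (q : nat) X : Prop :=
  (forall n, X n < X n.+1) /\ (forall n, X (n + q)%N = X n + 1).

Definition points X : set (circle R) := range (fun n => to_circle (X n)).

Lemma circular_lt q X : circular q X -> forall m n, (X m < X n) = (m < n)%N.
Proof.
case=> inc _ m n.
have h := Order.NatMonotonyTheory.homo_ltn_lt inc.
case: (ltngtP m n) => [mn|nm|->]; last by rewrite ltxx.
  by rewrite h.
by apply/negbTE; rewrite -leNgt ltW // h.
Qed.


Lemma circular_le q X : circular q X -> forall m n, (X m <= X n) = (m <= n)%N.
Proof. by move=> cX m n; rewrite leNgt (circular_lt cX) -leqNgt. Qed.

Lemma circular_addM q X : circular q X ->
  forall n k, X (n + k * q)%N = X n + k%:R.
Proof.
case=> _ per n; elim => [|k IHk]; first by rewrite mul0n addn0 addr0.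
by rewrite mulSnr addnA per IHk -addrA -natr1.
Qed.

Lemma circular_modn q X : circular q X ->
  forall n, X n - X (n %% q)%N \is a Num.int.
Proof.
move=> cX n; rewrite {1}(divn_eq n q) addnC (circular_addM cX).
by rewrite addrC addKr natr_int.
Qed.

Lemma circular_inj q X (i j : 'I_q) : circular q X ->
  X i - X j \is a Num.int -> i = j.
Proof.
move=> cX Xint; apply: ord_inj; wlog ij : i j Xint / (i <= j)%N.
  move=> W; case: (leqP i j) => [/W|/ltnW /W e]; first exact.
  by apply/esym/e; rewrite -opprB rpredN.
apply/eqP; rewrite eqn_leq ij /= -(circular_le cX) -subr_le0 leNgt.
apply/negP => lt0.
have lt1 : X j - X i < 1.
  rewrite ltrBlDl -cX.2 (circular_lt cX).
  by rewrite (leq_trans (ltn_ord j)) // leq_addl.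
move: Xint; rewrite -rpredN opprB => /intrP [z zE].
by move: lt0 lt1; rewrite zE -[0]/(0%:~R) -[1]/(1%:~R) !ltr_int; lia.
Qed.

Lemma circular_shift q X k : circular q X -> circular q (fun n => X (k + n)%N).
Proof.
case=> inc per; split=> n; first by rewrite addnS; exact: inc.
by rewrite addnA; exact: per.
Qed.

Lemma circular_translate q X a : circular q X -> circular q (fun n => X n + a).
Proof.
case=> inc per; split=> n; first by rewrite ltrD2r.
by rewrite per addrAC.
Qed.

Lemma points_shift q X k : (0 < q)%N -> circular q X ->
  points (fun n => X (k + n)%N) = points X.
Proof.
move=> q0 cX; apply/seteqP; split=> t [n _ <-]; first by exists (k + n)%N.
exists (n + k * q - k)%N => //; apply/to_circle_eq.
have kq : (k <= n + k * q)%N by rewrite (leq_trans (leq_pmulr k q0)) ?leq_addl.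
by rewrite subnKC // (circular_addM cX) addrC addKr natr_int.
Qed.

Lemma rotate_back_points X a :
  rotate_back a (points X) = points (fun n => X n - a).
Proof.
apply/seteqP; split=> [t [u [n _ <-] <-]|t [n _ <-]].
  by exists n; rewrite // raddfB.
by exists (to_circle (X n)); [exists n|rewrite raddfB].
Qed.

(** Such a [z] differs by an integer [k] from one of the first [q] terms; these
    are less than [X 0 + 1], so [k] is nonnegative and adding it is a shift by
    [k * q] terms. *)
Lemma points_enum q X z : (0 < q)%N -> circular q X ->
  X 0%N <= z -> points X (to_circle z) -> exists n, z = X n.
Proof.
move=> q0 cX Xz [m _ /to_circle_eq e].
have : z - X (m %% q)%N \is a Num.int.
  apply: eq_int (rpredB (circular_modn cX m) e) _.
  by ring.
case/intrP => [[k|k]] kE; first last.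
  have lt1 : X (m %% q)%N < X 0%N + 1.
    by rewrite -(cX.2 0%N) (circular_lt cX) add0n ltn_pmod.
  have : - 1 < (Negz k)%:~R :> R by rewrite -kE; lra.
  by rewrite -[-1]/((-1)%:~R) ltr_int; lia.
exists (m %% q + k * q)%N; rewrite (circular_addM cX).
by rewrite -[k%:R]/((Posz k)%:~R) -kE addrC subrK.
Qed.

(** Both sequences list the same lifted set in increasing order, so they differ
    only by the place where the enumeration starts. *)
Lemma points_inj q X Y : (0 < q)%N -> circular q X -> circular q Y ->
  points X = points Y -> X 0%N <= Y 0%N ->
  exists m, forall n, Y n = X (m + n)%N.
Proof.
move=> q0 cX cY XY le0.
have Yin n : exists p, Y n = X p.
  apply: points_enum q0 cX _ _; last by rewrite XY; exists n.
  by rewrite (le_trans le0) // (circular_le cY).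
have [m mE] := Yin 0%N; exists m; elim=> [|n IHn]; first by rewrite addn0.
apply/le_anti/andP; split.
  have [p pE] : exists p, X (m + n.+1)%N = Y p.
    apply: points_enum q0 cY _ _; last by rewrite -XY; exists (m + n.+1)%N.
    by rewrite mE (circular_le cX) leq_addr.
  rewrite pE (circular_le cY) -(circular_lt cY) IHn -pE.
  by rewrite (circular_lt cX) addnS.
have [p pE] := Yin n.+1.
rewrite pE (circular_le cX) addnS -(circular_lt cX) -IHn -pE.
by rewrite (circular_lt cY).
Qed.

(** A rotation that amounts to a shift of the index only permutes the points;
    for negative multiples, the roles of the set and of its image are
    exchanged. *)
Lemma points_rotation_sym q X p b (t : int) : (0 < q)%N -> circular q X ->
  (forall n, X (p + n)%N = X n + b) ->
  points (fun n => X n + t%:~R * b) = points X.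
Proof.
move=> q0.
have pos Z (k : nat) : circular q Z -> (forall n, Z (p + n)%N = Z n + b) ->
    points (fun n => Z n + k%:R * b) = points Z.
  move=> cZ Zb; rewrite -(points_shift (k * p) q0 cZ); congr points.
  apply/funext => n; elim: k => [|k IHk]; first by rewrite mul0r addr0.
  by rewrite mulSn -addnA Zb -IHk -natr1; ring.
move=> cX Xb; case: t => k; first exact: pos.
rewrite -[LHS](pos _ k.+1); first 1 last.
- exact: circular_translate.
- by move=> n; rewrite Xb addrAC.
by congr points; apply/funext => n; rewrite NegzE mulrNz; ring.
Qed.

(** * Lifts of realizations *)

Definition is_lift (q d : nat) (sigma : {perm 'I_q}) X : Prop :=
  circular q X /\
  forall i : 'I_q, d%:R * X i - X (sigma i) \is a Num.int.

Lemma realizes_lift (q d : nat) (sigma : {perm 'I_q}) (O : set (circle R)) :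
  (0 < q)%N -> realizes d sigma O ->
  exists2 X, is_lift d sigma X & O = points X.
Proof.
case: q sigma => // q sigma _ [x [x01 xinc -> xd]].
(* The labelling in [(0, 1)] is extended by adding a full turn each time the
   index passes a multiple of [q]. *)
pose X (n : nat) : R := x (inord (n %% q.+1)) + (n %/ q.+1)%:R.
have XE (i : 'I_q.+1) : X i = x i.
  by rewrite /X modn_small // divn_small // inord_val addr0.
exists X; last first.
  apply/seteqP; split=> t [n _ <-]; first by exists n; rewrite ?XE.
  exists (inord (n %% q.+1)) => //; apply/esym/to_circle_eq.
  by rewrite /X addrC addKr natr_int.
split; last first.
  move=> i; rewrite !XE; apply/to_circle_eq; rewrite -xd /mult_map -raddfMn.
  by rewrite mulr_natl.
split=> n; last by rewrite /X modnDr divnDr // divnn /= natrD addrA.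
rewrite /X modnS divnS //; case: ifP => dv.
  rewrite natrD addrA ltrD2r.
  have /andP [_ lt1] := x01 (inord (n %% q.+1)).
  have /andP [gt0 _] := x01 (inord 0).
  by rewrite (lt_trans lt1) // ltrDr.
rewrite add0n ltrD2r; apply: xinc.
have lt : (n %% q.+1 < q)%N.
  rewrite ltn_neqAle -ltnS ltn_pmod // andbT; apply/eqP => e.
  by move: dv; rewrite /dvdn -addn1 -modnDml e addn1 modnn.
by rewrite !inordK // ltnS ltnW.
Qed.

(** With the term [k] taken as the first point, the label [i] stands for the
    former label [rho ^+ k] of [i], so [sigma] becomes its conjugate by
    [rho ^- k]. *)
Lemma lift_shift (q d : nat) (sigma : {perm 'I_q}) X (k : nat) :
  is_lift d sigma X ->
  is_lift d (sigma ^ (rho q ^- k))%g (fun n => X (k + n)%N).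
Proof.
case=> cX dX; split; first exact: circular_shift.
have modX (i : 'I_q) : X (k + i)%N - X ((rho q ^+ k)%g i) \is a Num.int.
  by rewrite rho_expE addnC; exact: circular_modn.
move=> i; set j := (sigma ^ (rho q ^- k))%g i.
have jE : (rho q ^+ k)%g j = sigma ((rho q ^+ k)%g i).
  by rewrite /j -{1}(permK (rho q ^+ k)%g i) permJ permKV.
have h : d%:R * (X (k + i)%N - X ((rho q ^+ k)%g i)) \is a Num.int.
  by rewrite rpredM // ?modX ?natr_int.
apply: eq_int (rpredB (rpredD (dX ((rho q ^+ k)%g i)) h) (modX j)) _.
by rewrite jE; ring.
Qed.

(** The angles that occur are the fixed points of multiplication by [d] on the
    circle: rotations by these angles are the ones that commute with it. *)
Lemma lift_translate (q d : nat) (sigma : {perm 'I_q}) X (a : R) :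
  (0 < d)%N -> d.-1%:R * a \is a Num.int ->
  is_lift d sigma X -> is_lift d sigma (fun n => X n + a).
Proof.
case: d => // d _ aint [cX dX]; split; first exact: circular_translate.
move=> i; apply: eq_int (rpredD (dX i) aint) _.
by rewrite /= -natr1; ring.
Qed.

Lemma lift_inj (q d : nat) (sigma sigma' : {perm 'I_q}) X :
  is_lift d sigma X -> is_lift d sigma' X -> sigma = sigma'.
Proof.
case=> cX dX [_ dX']; apply/permP => i; apply: circular_inj cX _.
by apply: eq_int (rpredB (dX' i) (dX i)) _; ring.
Qed.

(** A point whose lift is an integer is fixed by multiplication by [d], so it
    cannot occur here; then [0] falls strictly between two consecutive terms of
    the lift, and starting the enumeration there gives an increasing labelling
    in [(0, 1)], at the cost of conjugating by a power of [rho]. *)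
Lemma lift_realizes (q d : nat) (sigma : {perm 'I_q}) X : (0 < q)%N ->
  (0 < d)%N -> (forall i, sigma i != i) -> is_lift d sigma X ->
  exists2 sigma', sigma' \in comb_type sigma & realizes d sigma' (points X).
Proof.
move=> q0 d0 nofix liftX; have [cX dX] := liftX.
have nonint n : X n \isn't a Num.int.
  apply/negP => Xint; pose i := Ordinal (ltn_pmod n q0).
  have Xi : X i \is a Num.int.
    by apply: eq_int (rpredB Xint (circular_modn cX n)) _; ring.
  case/eqP: (nofix i); apply: circular_inj cX _.
  have dXi : d%:R * X i \is a Num.int by rewrite rpredM // natr_int.
  by apply: eq_int (rpredB (rpredB dXi (dX i)) Xi) _; ring.
(* [m] is the least integer above [X 0], and [k + 1] the first index past it. *)
pose m := (Num.floor (X 0%N) + 1)%:~R : R.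
have /andP [mle mgt] : m - 1 <= X 0%N < m.
  by rewrite /m intrD addrK -[X in _ + X]/(1%:~R) -intrD floor_itv.
have exk : exists k, m <= X k by exists q; rewrite -[q]add0n cX.2 -lerBlDr.
case: (ex_minnP exk) => -[|k] mk mink.
  by move: mk; rewrite leNgt mgt.
have Xk : X k < m by rewrite ltNge; apply/negP => /mink; rewrite ltnn.
pose Y n := X (k.+1 + n)%N - m.
have liftY : is_lift d (sigma ^ (rho q ^- k.+1))%g Y.
  apply: (@lift_translate _ _ _ (fun n => X (k.+1 + n)%N) (- m) d0).
    by rewrite mulrN rpredN rpredM ?natr_int ?intr_int.
  exact: lift_shift.
have [cY dY] := liftY.
exists (sigma ^ (rho q ^- k.+1))%g.
  by apply/orbitP; exists (rho q ^- k.+1)%g; rewrite // groupV mem_cycle.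
exists (fun i => Y i); split.
- move=> i; apply/andP; split.
    apply: lt_le_trans (_ : Y 0%N <= _); last by rewrite (circular_le cY).
    rewrite /Y addn0 subr_gt0 lt_neqAle mk andbT; apply/eqP => e.
    by have := nonint k.+1; rewrite -e intr_int.
  apply: le_lt_trans (_ : Y q.-1 < _).
    by rewrite (circular_le cY) -ltnS prednK.
  by rewrite /Y addSnnS prednK // cX.2 ltrBlDr addrC ltrD2l.
- by move=> i j ij; rewrite (circular_lt cY).
- (* The labelling has only the first [q] terms of [Y], so both inclusions are
     up to the integers [m] and [n %/ q]. *)
  rewrite -(points_shift k.+1 q0 cX); apply/seteqP; split=> t [n _ <-].
    exists (Ordinal (ltn_pmod n q0)) => //; apply/to_circle_eq.
    pose z := Num.floor (X 0%N) + 1.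
    apply: eq_int (rpredNr (rpredD (circular_modn cY n) (intr_int R z))) _.
    by rewrite /Y /= -/m; ring.
  exists (nat_of_ord n) => //; apply/to_circle_eq.
  by rewrite /Y opprB addrCA subrr addr0 intr_int.
- by move=> i; rewrite /mult_map -raddfMn -mulr_natl; apply/to_circle_eq.
Qed.

(** * Rigidity *)

(** The two sides differ by an integer exceeding [-1], since the left side is
    positive and the right side, the length of an arc, is at most [1]. These nonnegative
    integers sum to [d - des sigma = 0]: the arcs between consecutive points
    have total length [1], and the image arcs have total length [des sigma]. *)
Lemma lift_gap (q d : nat) (sigma : {perm 'I_q}) X (i : 'I_q) :
  des sigma = d -> (0 < d)%N -> is_lift d sigma X ->
  d%:R * (X i.+1 - X i) =
    X (sigma (ordS i)) - X (sigma i) + (sigma (ordS i) < sigma i)%N%:R.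
Proof.
move=> desd d0 [cX dX].
pose D j : R := (sigma (ordS j) < sigma j)%N%:R.
(* [N j] counts the extra full turns made by the image of the arc [j]. *)
pose N (j : 'I_q) : R := d%:R * (X j.+1 - X j) -
  (X (sigma (ordS j)) - X (sigma j) + D j).
suff N0 : N i = 0 by apply/eqP; rewrite -subr_eq0; apply/eqP.
have Nge0 j : 0 <= N j.
  have Nint : N j \is a Num.int.
    have Sint := rpredM (natr_int R d) (circular_modn cX j.+1).
    have Dint : D j \is a Num.int by exact: natr_int.
    apply: eq_int (rpredB (rpredB (rpredD (dX (ordS j)) Sint) (dX j)) Dint) _.
    by rewrite /N /=; ring.
  have pos : 0 < d%:R * (X j.+1 - X j).
    by rewrite mulr_gt0 ?ltr0n // subr_gt0 cX.1.
  have arc : X (sigma (ordS j)) - X (sigma j) + D j <= 1.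
    rewrite /D; case: ltnP => lt /=.
      by rewrite -lerBrDr subrr subr_le0 (circular_le cX) ltnW.
    rewrite addr0 lerBlDl -cX.2 (circular_le cX).
    by rewrite (leq_trans (ltnW (ltn_ord _))) // leq_addl.
  case/intrP: Nint => z zE.
  have : - 1 < z%:~R :> R by rewrite -zE /N; lra.
  by rewrite zE -[-1]/((-1)%:~R) -[0]/(0%:~R) ltr_int ler_int; lia.
have sumN : \sum_j N j = 0.
  rewrite /N sumrB [X in _ - X]big_split /= sumrB -mulr_sumr.
  rewrite -(big_mkord xpredT (fun j => X j.+1 - X j)) telescope_sumr //.
  rewrite -{1}[q]add0n cX.2.
  rewrite [\sum_j X (sigma (ordS j))](_ : _ = \sum_j X (sigma j)); last first.
    by rewrite [RHS](reindex_inj (@ordS_inj q)).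
  have -> : \sum_j D j = d%:R.
    rewrite -desd /des -sum1_card natr_sum [RHS]big_mkcond /=.
    by apply: eq_bigr => j _; rewrite /D inE; case: ltnP.
  by ring.
by apply: (psumr_eq0P (P := xpredT) (F := N)) => //.
Qed.

(** By the gap identity the differences [u] of the two lifts satisfy
    [d * u - u \o sigma = c] for a single constant [c], an integer by the lift
    property. Then [v = u - c / (d - 1)] satisfies [v \o sigma = d * v]; running
    around a cycle of [sigma] multiplies [v] by a power of [d], so [v = 0]. *)
Lemma lift_rigid (q d : nat) (sigma : {perm 'I_q}) X Y :
  (0 < q)%N -> des sigma = d -> (2 <= d)%N ->
  is_lift d sigma X -> is_lift d sigma Y ->
  exists c : int, forall n, Y n = X n + c%:~R / d.-1%:R.
Proof.
move=> q0 desd d2 lX lY; have d0 : (0 < d)%N := ltnW d2.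
have [[cX dX] [cY dY]] := (lX, lY).
pose u n := Y n - X n.
have u_mod n : u (n %% q)%N = u n.
  rewrite /u [in RHS](divn_eq n q) addnC (circular_addM cX) (circular_addM cY).
  by ring.
pose i0 := Ordinal q0.
pose w (i : 'I_q) := d%:R * u i - u (sigma i).
(* The gap identities of the two lifts have the same descent term, so it cancels
   in their difference. *)
have wS (i : 'I_q) : w (ordS i) = w i.
  rewrite /w; have -> : u (ordS i) = u i.+1 by exact: u_mod.
  by have := lift_gap i desd d0 lX; have := lift_gap i desd d0 lY; rewrite /u; lra.
have wE i : w i = w i0.
  case: i; elim=> [|n IHn] lt; first by congr w; apply: ord_inj.
  rewrite -(IHn (ltnW lt)) -[in RHS]wS; congr w; apply: ord_inj.
  by rewrite /= modn_small.
have /intrP [c cE] : w i0 \is a Num.int.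
  by apply: eq_int (rpredB (dY i0) (dX i0)) _; rewrite /w /u; ring.
exists c => n.
have d1 : d.-1%:R != 0 :> R by rewrite pnatr_eq0; lia.
pose v (i : 'I_q) := u i - c%:~R / d.-1%:R.
have dE : d%:R = d.-1%:R + 1 :> R by rewrite natr1 prednK.
have vS i : v (sigma i) = d%:R * v i.
  have := wE i; rewrite cE /w /v dE => e.
  have -> : u (sigma i) = (d.-1%:R + 1) * u i - c%:~R by rewrite -e; ring.
  by field.
have vX i k : v ((sigma ^+ k)%g i) = d%:R ^+ k * v i.
  elim: k => [|k IHk]; first by rewrite expg0 perm1 expr0 mul1r.
  by rewrite expgSr permM vS IHk exprS mulrA.
have v0 i : v i = 0.
  have := vX i #[sigma]%g; rewrite expg_order perm1 => /eqP.
  rewrite -subr_eq0 -{1}[v i]mul1r -mulrBl mulf_eq0 => /orP [|/eqP //].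
  by rewrite subr_eq0 eq_sym gt_eqF // exprn_egt1 ?ltr1n // -lt0n order_gt0.
have := v0 (Ordinal (ltn_pmod n q0)); rewrite /v /= u_mod /u; lra.
Qed.

(** Shifting by [q / s] terms conjugates [sigma] to itself, so by rigidity it is
    a rotation by some multiple [b] of [1 / (d - 1)]; its [s]-th iterate is the
    shift by [q] terms, a full turn, whence [s * b = 1]. *)
Lemma lift_symmetry (q d : nat) (sigma : {perm 'I_q}) X :
  (0 < q)%N -> des sigma = d -> (2 <= d)%N -> is_lift d sigma X ->
  let s := sym_order sigma in
  (s %| d.-1)%N /\ forall n, X (q %/ s + n)%N = X n + s%:R^-1.
Proof.
move=> q0 desd d2 lX s; have [cX dX] := lX.
have [sq stab] := sym_order_stab sigma q0; rewrite -/s in sq stab.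
set p := (q %/ s)%N in stab *.
have fixp : (sigma ^ (rho q ^+ p))%g = sigma by apply/stab.
have := lift_shift p lX; rewrite -{1}fixp conjgK => lpX.
have [c cE] := lift_rigid q0 desd d2 lX lpX.
set b := c%:~R / _ in cE.
have iter k : X (k * p)%N = X 0%N + k%:R * b.
  elim: k => [|k IHk]; first by rewrite mul0r addr0.
  by rewrite mulSn cE IHk -natr1; ring.
have sb : s%:R * b = 1.
  have := iter s; rewrite mulnC divnK // -[q]add0n cX.2; lra.
have s0 : s%:R != 0 :> R by apply/eqP => e; move: sb; rewrite e; lra.
have bE : b = s%:R^-1 by apply: (mulfI s0); rewrite sb divff.
split; last by move=> n; rewrite cE bE.
have d1 : d.-1%:R != 0 :> R by rewrite pnatr_eq0; lia.
have : (s%:Z * c)%:~R = d.-1%:R :> R.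
  have : s%:R * b * d.-1%:R = d.-1%:R by rewrite sb mul1r.
  by rewrite /b mulrA divfK // intrM.
rewrite -[d.-1%:R]/((Posz d.-1)%:~R) => /intr_inj e.
by apply/dvdnP; exists `|c|%N; move: (congr1 absz e); rewrite abszM /= mulnC.
Qed.

End Lifts.

(** * The realizations of a combinatorial type *)

Theorem theorem6p6 (R : realType) (q d s : nat) (tau : {set {perm 'I_q}})
    (sigma : {perm 'I_q}) (O : set (circle R)) :
  (2 <= q)%N ->
  tau \in comb_types q ->
  des_type tau = d -> (2 <= d)%N ->
  sym_type tau = s ->
  sigma \in tau ->
  last 0%N (sig sigma) = 1%N ->
  realizes d sigma O ->
  let copy (j : nat) := rotate_back (j%:R / (d.-1)%:R) O in
  [/\ (s %| d.-1)%N,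
      forall O' : set (circle R),
        realizes_type d tau O' <->
        (exists2 j : nat, (j < d.-1 %/ s)%N & O' = copy j),
      forall j k : nat, (j < d.-1 %/ s)%N -> (k < d.-1 %/ s)%N ->
        copy j = copy k -> j = k
    & forall j : nat, (j < d.-1 %/ s)%N ->
        rotate_back (s%:R^-1) (copy j) = copy j].
Proof.
move=> q2 tauP desd d2 syms sigma_tau _ realO copy.
have q0 : (0 < q)%N := ltnW q2; have d0 : (0 < d)%N := ltnW d2.
rewrite (des_typeE tauP sigma_tau) in desd.
rewrite (sym_typeE tauP sigma_tau) in syms.
have tauE := comb_types_eq tauP sigma_tau.
have nofix i : sigma i != i.
  case/imsetP: tauP => sigma0 cyc0 tauE0; move: sigma_tau; rewrite tauE0.
  case/orbitP => r _ <- /=.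
  by rewrite -(permKV r i) permJ (inj_eq perm_inj) qcycle_nofix.
have [X lX OX] := realizes_lift q0 realO.
have [sd symX] := lift_symmetry q0 desd d2 lX; rewrite syms in sd symX.
have d1 : d.-1%:R != 0 :> R by rewrite pnatr_eq0; lia.
have s0 : (0 < s)%N.
  by rewrite lt0n; apply: contraL sd => /eqP ->; rewrite dvd0n; lia.
have sR : s%:R != 0 :> R by rewrite pnatr_eq0 -lt0n.
set e := (d.-1 %/ s)%N.
have e0 : (0 < e)%N by rewrite divn_gt0 // dvdn_leq //; lia.
have eE : s%:R^-1 = e%:R / d.-1%:R :> R.
  by rewrite -[in d.-1%:R](divnK sd) -/e natrM; field; rewrite sR pnatr_eq0 -lt0n.
pose Xc (j : nat) n := X n - j%:R / d.-1%:R.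
have copyE j : copy j = points (Xc j) by rewrite /copy OX rotate_back_points.
have lXc j : is_lift d sigma (Xc j).
  by apply: lift_translate => //; rewrite mulrN mulrC divfK // rpredN natr_int.
have symXc j n : Xc j (q %/ s + n)%N = Xc j n + s%:R^-1.
  by rewrite /Xc symX addrAC.
split=> //.
- move=> O'; split; last first.
    case=> j _ ->; rewrite copyE.
    have [sigma' sigma'P real'] := lift_realizes q0 d0 nofix (lXc j).
    by exists sigma'; rewrite // tauE.
  case=> sigma'; rewrite tauE => /orbitP [r /cycleP [k ->] <-] real'.
  have [X' lX' ->] := realizes_lift q0 real'.
  have := lift_shift k lX'; rewrite /= conjgK => lX'k.
  have [c cE] := lift_rigid q0 desd d2 lX lX'k.
  (* Multiples of [e / (d - 1) = 1 / s] leave every copy invariant, so only the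
     residue of [- c] modulo [e] matters. *)
  exists `|((- c) %% e)%Z|%N.
    by rewrite -ltz_nat gez0_abs ?modz_ge0 ?ltz_pmod //; lia.
  rewrite copyE -(points_shift k q0 lX'.1).
  set j := `|_|%N.
  rewrite -[RHS](points_rotation_sym (- ((- c) %/ e)%Z) q0 (lXc j).1 (symXc j)).
  congr points; apply/funext => n; rewrite cE /Xc.
  have jE : j%:R = ((- c) %% e)%Z%:~R :> R.
    rewrite -[j%:R]/((Posz j)%:~R) /j gez0_abs ?modz_ge0 //; lia.
  rewrite jE eE.
  have -> : c%:~R = - ((- c) %/ e)%Z%:~R * e%:R - ((- c) %% e)%Z%:~R :> R.
    rewrite -[c in LHS]opprK {1}(divz_eq (- c) e) -[e%:R]/((Posz e)%:~R).
    by rewrite mulrNz intrD intrM; ring.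
  by rewrite mulrNz; ring.
- have inj j k : (j <= k)%N -> (k < e)%N -> copy j = copy k -> j = k.
    move=> jk ke; rewrite !copyE => jkE.
    have [m mE] : exists m, forall n, Xc j n = Xc k (m + n)%N.
      apply: points_inj q0 (lXc k).1 (lXc j).1 _ _ => //.
      by rewrite /Xc lerD2l lerN2 ler_pM2r ?invr_gt0 ?ltr0n ?ler_nat //; lia.
    have lm : is_lift d sigma (fun n => Xc k (m + n)%N).
      by have -> : (fun n => Xc k (m + n)%N) = Xc j by apply/funext => n.
    have fixm := lift_inj (lift_shift m (lXc k)) lm.
    have /(sym_order_stab sigma q0).2 : (sigma ^ (rho q ^+ m))%g = sigma.
      by rewrite -{1}fixm conjgKV.
    rewrite syms => pm.
    (* A nontrivial shift of this kind advances by at least [q / s] terms, that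
       is, by an angle of at least [1 / s = e / (d - 1)]; but [k - j < e]. *)
    apply/eqP; rewrite eqn_leq jk /= leqNgt; apply/negP => ltjk.
    have m0 : (0 < m)%N.
      rewrite lt0n; apply/eqP => m0; have := mE 0%N; rewrite m0 /Xc => /eqP.
      rewrite (inj_eq (addrI _)) eqr_opp (inj_eq (mulIf _)) ?invr_eq0 //.
      by rewrite eqr_nat; lia.
    have : Xc k (q %/ s + 0)%N <= Xc j 0%N.
      by rewrite mE (circular_le (lXc k).1) !addn0 dvdn_leq.
    rewrite symXc eE /Xc addrAC -addrA lerD2l -mulrBl -mulNr ler_pM2r.
      rewrite lerNr opprB lerBrDr -natrD ler_nat; lia.
    by rewrite invr_gt0 ltr0n; lia.
  move=> j k je ke jkE; case: (leqP j k) => [|/ltnW] le; first exact: inj.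
  by apply/esym/inj.
- move=> j _; rewrite copyE rotate_back_points.
  rewrite -[RHS](points_rotation_sym (- 1) q0 (lXc j).1 (symXc j)).
  by congr points; apply/funext => n; rewrite mulN1r.
Qed.
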